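(* Let $T>0$, $p>0$, $c\in\mathbb{R}$, and let $e\in C(\mathbb{R})$ be $T$-periodic with $\int_0^T e(t)\,dt=0$. For $\mu\in\mathbb{R}$ consider the problem $$u''(t)+c\,u'(t)+\frac{1}{u^p(t)}=\mu+e(t),\qquad u(t+T)=u(t).\qquad ( * )$$ Then $( * )$ has a unique positive $T$-periodic classical solution if and only if $\mu>0$. Moreover, write each positive $T$-periodic solution as $u(t)=\xi+U(t)$ with $\xi\in\mathbb{R}$ and $\int_0^T U(t)\,dt=0$. Then $\xi$ is a global parameter: the value of $\xi$ uniquely identifies the solution pair $(u(t),\mu)$. All positive $T$-periodic solutions lie on a unique (hyperbola-like) curve $\mu=\varphi(\xi)$; that is, the set of pairs $(\xi,\mu)$ arising from positive $T$-periodic solutions of $( * )$ is the graph of a function $\varphi$. The function $\varphi$ is continuous and decreasing, it is defined for all $\xi\in(0,\infty)$, and $$\lim_{\xi\to 0}\varphi(\xi)=\infty,\qquad \lim_{\xi\to\infty}\varphi(\xi)=0 .$$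
   Context: A positive $T$-periodic classical solution of $( * )$ is a $T$-periodic function $u\in C^2(\mathbb{R})$ with $u(t)>0$ for all $t$ that satisfies the equation for all $t$. A solution pair is $(u,\mu)$ with $\mu\in\mathbb{R}$ and $u$ a positive $T$-periodic solution of $( * )$ for that $\mu$. The number $\xi=\frac1T\int_0^T u(t)\,dt$ is the average of $u$. ''Hyperbola-like'' is only a descriptive word for the listed properties of $\varphi$ (continuity, monotonicity, domain, and limits). *)

(* Defs.v *)
From Stdlib Require Import Reals.
From Coquelicot Require Import Coquelicot.
Open Scope R_scope.

Definition periodic (T : R) (f : R -> R) : Prop :=
  forall t, f (t + T) = f t.

(* [Derive] is total with a junk value at points of non-differentiability,
   hence the explicit [ex_derive] conditions. *)
Definition C2 (u : R -> R) : Prop :=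
  (forall t, ex_derive u t) /\
  (forall t, ex_derive (Derive u) t) /\
  (forall t, continuous (Derive (Derive u)) t).

(* [Rpower x p] is [exp (p * ln x)], i.e. x^p for x > 0; it is only used
   here together with [0 < u t]. *)
Definition solves_equation (p c : R) (e : R -> R) (mu : R) (u : R -> R) : Prop :=
  forall t,
    Derive (Derive u) t + c * Derive u t + 1 / Rpower (u t) p = mu + e t.

Definition positive_periodic_solution
    (T p c : R) (e : R -> R) (mu : R) (u : R -> R) : Prop :=
  C2 u /\ periodic T u /\ (forall t, 0 < u t) /\ solves_equation p c e mu u.

Definition average (T : R) (u : R -> R) : R := 1 / T * RInt u 0 T.

(* u = xi + U with U integrable of zero integral over a period. *)
Definition mean_decomposition (T : R) (u : R -> R) (xi : R) (U : R -> R) : Prop :=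
  (forall t, u t = xi + U t) /\ is_RInt U 0 T 0.

(* Main.v *)
Require Import Defs.
From Stdlib Require Import Reals.
From Coquelicot Require Import Coquelicot.
From Stdlib Require Import Ranalysis5 Lra Lia ClassicalEpsilon FunctionalExtensionality.
Open Scope R_scope.

(** The nonlinearity [1 / x^p] decreases on the positive half-line, so the
    equation obeys a maximum principle: at a positive maximum of the difference
    of two periodic functions the first derivatives agree and the second
    derivative of the difference is not positive. This is [comparison], and
    everything about solutions comes from it.

    Comparing two solutions shows that they decrease as [mu] increases
    ([solution_antitone]). This gives uniqueness for a fixed [mu], and the sharper
    forms [solution_strict_gap] and [solution_lipschitz] say that the average of
    the solution is a strictly decreasing, locally Lipschitz function of [mu].
    Comparing a solution with constants and with shifts of a periodic function
    [E] satisfying [E'' + c E' = e] (which exists because [e] has mean zero) gives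
    the rest: [mu] must be positive ([solution_mu_pos]), solutions are uniformly
    large for [mu] near 0 ([solution_lower_bound]) and uniformly small for some
    large [mu] ([solution_small]). By the intermediate value theorem every
    positive number is then the average of exactly one solution.

    Existence for [mu > 0] ([solution_exists]) uses a constant lower solution and
    an upper solution [E + K]. Between them the singular term has slopes bounded
    above and below by negative numbers, and it may be continued to the line with
    the same bounds. For such nonlinearities the periodic problem is a fixed-point
    problem for a contraction ([periodic_solution_bilipschitz]): the resolvent of
    [u'' + c u' - M u] is explicit, and its norm [1 / M] is again a consequence of
    the maximum principle.

    The curve [phi] is the inverse of the map from [mu] to the average, hence a
    decreasing bijection of the positive half-line onto itself, and continuity
    and both limits hold for any such bijection
    ([decreasing_bijection_limits]). *)

Set Bullet Behavior "Strict Subproofs".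

(** * The maximum principle for periodic functions *)

(** Naming the two derivatives makes the class visibly closed under linear
    combinations, without side conditions on the total operator [Derive]. *)
Definition jet2 (w w1 w2 : R -> R) : Prop :=
  (forall t, is_derive w t (w1 t)) /\ (forall t, is_derive w1 t (w2 t)).

Lemma derive_continuous (f : R -> R) (t l : R) : is_derive f t l -> continuous f t.
Proof. intros H. apply (ex_derive_continuous (K := R_AbsRing) (V := R_NormedModule) f t). now exists l. Qed.

Lemma jet2_comb (a b : R) u u1 u2 v v1 v2 k :
  jet2 u u1 u2 -> jet2 v v1 v2 ->
  jet2 (fun t => a * u t + b * v t + k)
       (fun t => a * u1 t + b * v1 t) (fun t => a * u2 t + b * v2 t).
Proof.
  intros [Hu Hu1] [Hv Hv1]. split; intros t.
  - auto_derive.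
    + repeat split; [now exists (u1 t) | now exists (v1 t)].
    + rewrite (is_derive_unique (fun x : R => u x) _ _ (Hu t)), (is_derive_unique (fun x : R => v x) _ _ (Hv t)). ring.
  - auto_derive.
    + repeat split; [now exists (u2 t) | now exists (v2 t)].
    + rewrite (is_derive_unique (fun x : R => u1 x) _ _ (Hu1 t)), (is_derive_unique (fun x : R => v1 x) _ _ (Hv1 t)). ring.
Qed.

Lemma periodic_IZR T f : periodic T f -> forall (z : Z) t, f (t + IZR z * T) = f t.
Proof.
  intros Hf. induction z as [|z IH|z IH] using Z.peano_ind; intros t.
  - f_equal; ring.
  - rewrite succ_IZR, <- (IH t), <- (Hf (t + IZR z * T)). f_equal; ring.
  - rewrite <- Hf. rewrite <- (IH t). f_equal. unfold Z.pred. rewrite plus_IZR. ring.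
Qed.

Lemma periodic_fundamental T f :
  0 < T -> periodic T f -> forall t, exists s, 0 <= s <= T /\ f s = f t.
Proof.
  intros HT Hf t.
  destruct (base_Int_part (t / T)) as [H1 H2].
  set (z := Int_part (t / T)) in *.
  exists (t + IZR (- z) * T). split.
  - rewrite opp_IZR. assert (Ht : t = t / T * T) by (field; lra).
    set (q := t / T) in *. rewrite Ht. nra.
  - now apply periodic_IZR.
Qed.

(** Periodicity makes up for the noncompactness of the line: the maximum over
    one closed period is a maximum over all times. *)
Lemma periodic_max T f :
  0 < T -> periodic T f -> (forall t, continuous f t) ->
  exists t0, forall t, f t <= f t0.
Proof.
  intros HT Hf Hc.
  destruct (continuity_ab_maj f 0 T) as [t0 [H0 _]]; [lra| |].
  - intros x _. apply continuity_pt_filterlim, Hc.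
  - exists t0. intros t.
    destruct (periodic_fundamental T f HT Hf t) as [s [Hs <-]]. now apply H0.
Qed.

Lemma periodic_bounded T f :
  0 < T -> periodic T f -> (forall t, continuous f t) ->
  exists b, 0 < b /\ forall t, Rabs (f t) <= b.
Proof.
  intros HT Hf Hc.
  destruct (periodic_max T (fun t => Rabs (f t)) HT) as [t0 H0].
  - intros t. now rewrite Hf.
  - intros t. apply continuous_comp; [apply Hc | apply continuous_Rabs].
  - exists (Rabs (f t0) + 1). split.
    + pose proof (Rabs_pos (f t0)). lra.
    + intros t. pose proof (H0 t). simpl in H. lra.
Qed.

(** If [w2 t0] were positive then [w1], which vanishes at [t0], would be
    positive just to the right of [t0], and [w] would exceed its maximum
    there. *)
Lemma second_derivative_at_max w w1 w2 t0 :
  jet2 w w1 w2 -> (forall t, w t <= w t0) -> w1 t0 = 0 /\ w2 t0 <= 0.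
Proof.
  intros [Hw Hw1] Hmax.
  assert (Hcrit : w1 t0 = 0).
  { assert (Hd : derivable_pt_lim w t0 (w1 t0)) by apply is_derive_Reals, Hw.
    pose (pr := exist _ (w1 t0) Hd : derivable_pt w t0).
    apply (deriv_maximum w (t0 - 1) (t0 + 1) t0 pr); try lra.
    intros; apply Hmax. }
  split; [exact Hcrit|].
  destruct (Rle_or_lt (w2 t0) 0) as [|Hpos]; [assumption | exfalso].
  assert (Hd : derivable_pt_lim w1 t0 (w2 t0)) by apply is_derive_Reals, Hw1.
  destruct (Hd (w2 t0) Hpos) as [d Hd'].
  assert (Hpos1 : forall h, 0 < h < d -> 0 < w1 (t0 + h)).
  { intros h Hh. specialize (Hd' h).
    assert (h <> 0) by lra. assert (Rabs h < d) by (rewrite Rabs_pos_eq; lra).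
    specialize (Hd' H H0). apply Rabs_def2 in Hd'. rewrite Hcrit in Hd'.
    destruct Hd' as [_ Hd'].
    assert (0 < (w1 (t0 + h) - 0) / h) by lra.
    apply (Rmult_lt_compat_r h) in H1; [|lra]. field_simplify in H1; lra. }
  pose proof (cond_pos d) as Hdpos.
  destruct (MVT_cor2 w w1 t0 (t0 + d / 2)) as [x [Hx1 Hx2]]; [lra| |].
  - intros; apply is_derive_Reals, Hw.
  - assert (0 < w1 x).
    { replace x with (t0 + (x - t0)) by ring. apply Hpos1. lra. }
    pose proof (Hmax (t0 + d / 2)). nra.
Qed.

Lemma maximum_principle T w w1 w2 :
  0 < T -> periodic T w -> jet2 w w1 w2 ->
  (forall t, 0 < w t -> w1 t = 0 -> 0 < w2 t) ->
  forall t, w t <= 0.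
Proof.
  intros HT Hp Hj Hpos t.
  destruct (periodic_max T w HT Hp) as [t0 H0].
  { intros s. eapply derive_continuous, (proj1 Hj). }
  destruct (second_derivative_at_max _ _ _ _ Hj H0) as [H1 H2].
  destruct (Rle_or_lt (w t0) 0) as [|H3].
  - specialize (H0 t). lra.
  - specialize (Hpos t0 H3 H1). lra.
Qed.

Lemma jet2_const (a : R) : jet2 (fun _ => a) (fun _ => 0) (fun _ => 0).
Proof. split; intros t; apply is_derive_Reals, derivable_pt_lim_const. Qed.

(** The maximum principle for [u - v - k], in the only form used below. At a
    positive maximum of the difference the first derivatives agree, so the
    strict inequality between the operators contradicts the sign of the second
    derivative. *)
Lemma comparison T c k u u1 u2 v v1 v2 :
  0 < T -> periodic T u -> periodic T v -> jet2 u u1 u2 -> jet2 v v1 v2 ->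
  (forall t, v t + k < u t -> v2 t + c * v1 t < u2 t + c * u1 t) ->
  forall t, u t <= v t + k.
Proof.
  intros HT Hu Hv Hju Hjv Hlt t.
  pose proof (jet2_comb 1 (-1) _ _ _ _ _ _ (- k) Hju Hjv) as Hw.
  enough (1 * u t + -1 * v t + - k <= 0) by lra.
  revert t. refine (maximum_principle T _ _ _ HT _ Hw _).
  - intros t. now rewrite Hu, Hv.
  - intros t Hpos Hcrit. cbv beta in *. specialize (Hlt t ltac:(lra)).
    replace (v1 t) with (u1 t) in Hlt by lra. lra.
Qed.

(** * Linear periodic problems *)

(** The defect [y (t + T) - y t] solves the homogeneous equation with zero
    initial value; the integrating factor makes it constant. *)
Lemma periodic_of_ode T lam f y :
  periodic T f -> (forall t, is_derive y t (f t - lam * y t)) -> y T = y 0 ->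
  periodic T y.
Proof.
  intros Hf Hy H0.
  set (z := fun t => exp (lam * t) * (y (t + T) - y t)).
  assert (Hz : forall t, is_derive z t 0).
  { intros t. unfold z. auto_derive.
    - repeat split; [eexists; apply Hy | now exists (f t - lam * y t)].
    - rewrite (is_derive_unique (fun x : R => y x) _ _ (Hy t)).
      rewrite (is_derive_unique (fun x : R => y x) _ _ (Hy (t+T))).
      rewrite Hf. ring. }
  assert (Hconst : forall t, z t = 0).
  { assert (z 0 = 0).
    { unfold z. rewrite Rplus_0_l, H0. ring. }
    intros t. destruct (Rtotal_order 0 t) as [Ht|[<-|Ht]]; [| assumption |].
    - rewrite <- (eq_is_derive z 0 t); auto.
    - rewrite (eq_is_derive z t 0); auto. }
  intros t. specialize (Hconst t). unfold z in Hconst.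
  pose proof (exp_pos (lam * t)).
  apply Rmult_integral in Hconst. lra.
Qed.

Lemma continuous_ex_RInt (f : R -> R) a b :
  (forall t, continuous f t) -> ex_RInt f a b.
Proof.
  intros Hf. apply (ex_RInt_continuous (V := R_CompleteNormedModule)).
  intros; apply Hf.
Qed.

Lemma primitive_derive (f : R -> R) (t : R) :
  (forall s, continuous f s) -> is_derive (fun x => RInt f 0 x) t (f t).
Proof.
  intros Hf. apply (is_derive_RInt (V := R_NormedModule) f _ 0 t); [|apply Hf].
  apply filter_forall. intros b.
  apply (RInt_correct (V := R_CompleteNormedModule)).
  now apply continuous_ex_RInt.
Qed.

(** The periodic solution of [y' + lam y = f]: variation of constants, with the
    initial value chosen so that [y T = y 0]. The choice is possible because
    [exp (lam * T) <> 1] when [lam <> 0]. *)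
Definition first_order (T lam : R) (f : R -> R) (t : R) : R :=
  exp (- (lam * t)) *
  (RInt (fun s => exp (lam * s) * f s) 0 T / (exp (lam * T) - 1)
   + RInt (fun s => exp (lam * s) * f s) 0 t).

Lemma exp_mul_continuous lam f :
  (forall t, continuous f t) -> forall t, continuous (fun s => exp (lam * s) * f s) t.
Proof.
  intros Hf t. apply (continuous_mult (fun s => exp (lam * s)) f); [|apply Hf].
  apply (derive_continuous _ _ (lam * exp (lam * t))). auto_derive; [trivial | ring].
Qed.

Lemma first_order_derive T lam f :
  (forall t, continuous f t) ->
  forall t, is_derive (first_order T lam f) t (f t - lam * first_order T lam f t).
Proof.
  intros Hf t. unfold first_order.
  set (C := _ / _).
  pose proof (primitive_derive _ t (exp_mul_continuous lam f Hf)) as HI.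
  set (I := fun x => RInt (fun s => exp (lam * s) * f s) 0 x) in *.
  change (is_derive (fun t => exp (- (lam * t)) * (C + I t)) t
            (f t - lam * (exp (- (lam * t)) * (C + I t)))).
  change (is_derive I t (exp (lam * t) * f t)) in HI.
  auto_derive.
  - eexists; apply HI.
  - rewrite (is_derive_unique (fun x : R => I x) _ _ HI), exp_Ropp.
    pose proof (exp_pos (lam * t)). field. lra.
Qed.

Lemma first_order_periodic T lam f :
  0 < T -> lam <> 0 -> (forall t, continuous f t) -> periodic T f ->
  periodic T (first_order T lam f).
Proof.
  intros HT Hl Hc Hf. apply (periodic_of_ode T lam f); auto.
  - now apply first_order_derive.
  - unfold first_order. rewrite RInt_point. unfold zero; simpl.
    replace (- (lam * 0)) with 0 by ring. rewrite exp_0, exp_Ropp.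
    pose proof (exp_pos (lam * T)).
    assert (exp (lam * T) <> 1).
    { intros He. rewrite <- exp_0 in He. apply exp_inv in He.
      apply Rmult_integral in He. lra. }
    field. split; lra.
Qed.

(** The characteristic polynomial [r^2 + c r - M] has one positive and one
    negative root, so the operator is a product of two first-order operators
    with nonzero coefficients, each of them invertible on periodic
    functions. *)
Lemma resolvent_exists T c M :
  0 < T -> 0 < M ->
  exists S : (R -> R) -> R -> R, forall f,
    (forall t, continuous f t) -> periodic T f ->
    periodic T (S f) /\
    exists u1 u2, jet2 (S f) u1 u2 /\ forall t, u2 t + c * u1 t - M * S f t = f t.
Proof.
  intros HT HM.
  set (d := sqrt (c * c + 4 * M)).
  assert (Hd : d * d = c * c + 4 * M) by (apply sqrt_sqrt; nra).
  set (l1 := (c - d) / 2). set (l2 := (c + d) / 2).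
  assert (Hprod : l1 * l2 = - M) by (unfold l1, l2; nra).
  assert (Hsum : l1 + l2 = c) by (unfold l1, l2; field).
  exists (fun f => first_order T l2 (first_order T l1 f)). intros f Hc Hf.
  assert (H1 : l1 <> 0) by (intros E; rewrite E in Hprod; lra).
  assert (H2 : l2 <> 0) by (intros E; rewrite E in Hprod; lra).
  set (y := first_order T l1 f).
  assert (Hy : forall t, is_derive y t (f t - l1 * y t)) by now apply first_order_derive.
  assert (Hyc : forall t, continuous y t) by (intros; eapply derive_continuous, Hy).
  assert (Hyp : periodic T y) by now apply first_order_periodic.
  set (u := first_order T l2 y).
  assert (Hu : forall t, is_derive u t (y t - l2 * u t)) by now apply first_order_derive.
  split; [now apply first_order_periodic|].
  exists (fun t => y t - l2 * u t),
         (fun t => f t - l1 * y t - l2 * (y t - l2 * u t)).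
  split; [split; [exact Hu|] |].
  - intros t. auto_derive.
    + repeat split; [eexists; apply Hy | eexists; apply Hu].
    + rewrite (is_derive_unique (fun x : R => y x) _ _ (Hy t)).
      rewrite (is_derive_unique (fun x : R => u x) _ _ (Hu t)). ring.
  - intros t. rewrite <- Hsum. replace M with (- (l1 * l2)) by lra. ring.
Qed.

(** Without a zeroth-order term the operator has the constants in its kernel, and
    zero mean of [e] is what makes the equation solvable. *)
Lemma periodic_solution_no_zero_order T c e :
  0 < T -> (forall t, continuous e t) -> periodic T e -> RInt e 0 T = 0 ->
  exists E E1 E2, periodic T E /\ jet2 E E1 E2 /\
    forall t, E2 t + c * E1 t = e t.
Proof.
  intros HT Hc Hp H0.
  assert (Hprim : forall f k, (forall t, continuous f t) -> periodic T f -> RInt f 0 T = 0 ->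
     (forall t, is_derive (fun x => RInt f 0 x + k) t (f t)) /\
     periodic T (fun x => RInt f 0 x + k)).
  { intros f k Hfc Hfp Hf0.
    assert (Hd : forall t, is_derive (fun x => RInt f 0 x + k) t (f t)).
    { intros t. rewrite <- (Rplus_0_r (f t)).
      apply (is_derive_plus (fun x => RInt f 0 x) (fun _ => k)).
      - now apply primitive_derive.
      - apply is_derive_Reals. apply derivable_pt_lim_const. }
    split; [exact Hd|].
    apply (periodic_of_ode T 0 f); auto.
    - intros t. rewrite Rmult_0_l, Rminus_0_r. apply Hd.
    - rewrite Hf0, RInt_point. reflexivity. }
  destruct (Req_dec c 0) as [->|Hc0].
  (* With c = 0 one integrates twice, and k gives the first primitive mean zero. *)
  - set (k := - (RInt (fun x => RInt e 0 x) 0 T) / T).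
    destruct (Hprim e k Hc Hp H0) as [HFd HFp].
    set (F := fun x => RInt e 0 x + k) in *.
    assert (HFc : forall t, continuous F t) by (intros; eapply derive_continuous, HFd).
    assert (HF0 : RInt F 0 T = 0).
    { unfold F. rewrite (RInt_plus (fun x => RInt e 0 x) (fun _ => k)).
      - rewrite RInt_const. unfold plus, scal; simpl. unfold mult; simpl. unfold k. field. lra.
      - apply ex_RInt_continuous. intros. eapply derive_continuous, primitive_derive, Hc.
      - apply ex_RInt_const. }
    destruct (Hprim F 0 HFc HFp HF0) as [HEd HEp].
    exists (fun x => RInt F 0 x + 0), F, e. split; [exact HEp|].
    split; [split; assumption|]. intros; ring.
  - destruct (Hprim e 0 Hc Hp H0) as [HFd HFp].
    set (F := fun x => RInt e 0 x + 0) in *.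
    assert (HFc : forall t, continuous F t) by (intros; eapply derive_continuous, HFd).
    assert (HE := first_order_derive T c F HFc).
    exists (first_order T c F), (fun t => F t - c * first_order T c F t),
           (fun t => e t - c * (F t - c * first_order T c F t)).
    split; [now apply first_order_periodic|]. split; [split; [exact HE|] |].
    + set (E := first_order T c F) in *. intros t. auto_derive.
      * repeat split; eexists; [apply HFd | apply HE].
      * rewrite (is_derive_unique (fun x : R => F x) _ _ (HFd t)).
        rewrite (is_derive_unique (fun x : R => E x) _ _ (HE t)). ring.
    + intros; ring.
Qed.

(** * Fixed points of uniform contractions *)

Lemma geometric_to_zero q K : 0 <= q < 1 -> is_lim_seq (fun n => q ^ n * K) 0.
Proof.
  intros Hq. evar_last.
  - apply is_lim_seq_scal_r, is_lim_seq_geom. rewrite Rabs_pos_eq; lra.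
  - simpl. f_equal. ring.
Qed.

(** Summing the geometric series of steps from [n] onwards bounds the distance of
    the limit from [u n]. *)
Lemma geometric_cauchy (q D : R) (u : nat -> R) :
  0 <= q < 1 -> (forall n, Rabs (u (S n) - u n) <= q ^ n * D) ->
  is_lim_seq u (real (Lim_seq u)) /\
  forall n, Rabs (Lim_seq u - u n) <= q ^ n * (D / (1 - q)).
Proof.
  intros Hq Hu.
  assert (HD : 0 <= D).
  { specialize (Hu 0%nat). simpl in Hu. pose proof (Rabs_pos (u 1%nat - u 0%nat)). lra. }
  assert (Hgap : forall n k, Rabs (u (n + k)%nat - u n) <= q ^ n * (D / (1 - q))).
  { intros n k.
    assert (Hsum : Rabs (u (n + k)%nat - u n) <= q ^ n * D * ((1 - q ^ k) / (1 - q))).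
    { induction k as [|k IH].
      - rewrite Nat.add_0_r, Rminus_diag, Rabs_R0. simpl. right. field. lra.
      - rewrite Nat.add_succ_r.
        replace (u (S (n + k)) - u n)
          with ((u (S (n + k)) - u (n + k)%nat) + (u (n + k)%nat - u n)) by ring.
        eapply Rle_trans; [apply Rabs_triang|].
        eapply Rle_trans; [apply Rplus_le_compat; [apply Hu | apply IH]|].
        rewrite pow_add. simpl. right. field. lra. }
    eapply Rle_trans; [exact Hsum|].
    pose proof (pow_le q n (proj1 Hq)). pose proof (pow_le q k (proj1 Hq)).
    replace (q ^ n * D * ((1 - q ^ k) / (1 - q)))
      with (q ^ n * (D / (1 - q)) * (1 - q ^ k)) by (field; lra).
    assert (0 <= D / (1 - q)).
    { apply Rmult_le_pos; [lra|]. left. apply Rinv_0_lt_compat. lra. }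
    assert (0 <= q ^ n * (D / (1 - q))) by now apply Rmult_le_pos.
    nra. }
  assert (Hsmall : forall eps, 0 < eps -> exists N, forall n, (N <= n)%nat ->
            q ^ n * (D / (1 - q)) < eps).
  { intros eps Heps.
    pose proof (geometric_to_zero q (D / (1 - q)) Hq) as Hl.
    apply is_lim_seq_spec in Hl. destruct (Hl (mkposreal eps Heps)) as [N HN].
    exists N. intros n Hn. specialize (HN n Hn). simpl in HN.
    apply Rabs_def2 in HN. lra. }
  assert (Hlim : is_lim_seq u (real (Lim_seq u))).
  { apply Lim_seq_correct', ex_lim_seq_cauchy_corr. intros eps.
    destruct (Hsmall (eps / 2)) as [N HN]; [pose proof (cond_pos eps); lra|].
    exists N. intros n m Hn Hm.
    pose proof (Hgap N (n - N)%nat) as H1. pose proof (Hgap N (m - N)%nat) as H2.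
    replace (N + (n - N))%nat with n in H1 by lia.
    replace (N + (m - N))%nat with m in H2 by lia.
    specialize (HN N (le_n N)).
    replace (u n - u m) with ((u n - u N) - (u m - u N)) by ring.
    eapply Rle_lt_trans; [apply Rabs_triang|]. rewrite Rabs_Ropp. lra. }
  split; [exact Hlim|]. intros n.
  apply (is_lim_seq_le (fun k => Rabs (u (k + n)%nat - u n)) (fun _ => q ^ n * (D / (1 - q)))
           (Finite (Rabs (Lim_seq u - u n))) (Finite (q ^ n * (D / (1 - q))))).
  - intros k. rewrite Nat.add_comm. apply Hgap.
  - apply (is_lim_seq_abs (fun k => u (k + n)%nat - u n) (Lim_seq u - u n)).
    apply is_lim_seq_minus'; [now apply is_lim_seq_incr_n | apply is_lim_seq_const].
  - apply is_lim_seq_const.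
Qed.

Lemma uniform_limit_continuous (un : nat -> R -> R) (u : R -> R) :
  (forall n t, continuous (un n) t) ->
  (forall eps, 0 < eps -> exists n, forall t, Rabs (u t - un n t) <= eps) ->
  forall t, continuous u t.
Proof.
  intros Hc Hu t. apply continuity_pt_filterlim.
  intros eps Heps. destruct (Hu (eps / 4)) as [n Hn]; [lra|].
  pose proof (Hc n t) as Hct. apply continuity_pt_filterlim in Hct.
  destruct (Hct (eps / 4)) as [d [Hd Hd']]; [lra|].
  exists d. split; [exact Hd|]. intros s Hs. specialize (Hd' s Hs).
  simpl in *. unfold R_dist in *.
  pose proof (Hn s) as H1. pose proof (Hn t) as H2.
  apply Rabs_le_between in H1. apply Rabs_le_between in H2.
  apply Rabs_def2 in Hd'. apply Rabs_def1; lra.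
Qed.

(** Banach's theorem in the uniform distance. The set [P] stands for a closed
    subset of the space of functions, and [Phi] is only assumed to contract
    on [P]; this avoids building a complete metric space of periodic
    functions. *)
Lemma contraction_fixed_point (P : (R -> R) -> Prop) (Phi : (R -> R) -> R -> R)
    (q D : R) (u0 : R -> R) :
  0 <= q < 1 ->
  (forall u, P u -> P (Phi u)) ->
  (forall u v d, P u -> P v -> (forall t, Rabs (u t - v t) <= d) ->
     forall t, Rabs (Phi u t - Phi v t) <= q * d) ->
  (forall un u, (forall n, P (un n)) ->
     (forall eps, 0 < eps -> exists n : nat, forall t, Rabs (u t - un n t) <= eps) -> P u) ->
  P u0 -> (forall t, Rabs (Phi u0 t - u0 t) <= D) ->
  exists u, P u /\ forall t, Phi u t = u t.
Proof.
  intros Hq HP Hcontr Hclosed H0 HD.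
  set (un := fun n => Nat.iter n Phi u0).
  assert (HPn : forall n, P (un n)) by (induction n; simpl; auto).
  assert (Hstep : forall n t, Rabs (un (S n) t - un n t) <= q ^ n * D).
  { induction n as [|n IH]; intros t.
    - simpl. rewrite Rmult_1_l. apply HD.
    - simpl pow. rewrite Rmult_assoc. apply (Hcontr (un (S n)) (un n)); auto. }
  set (u := fun t => real (Lim_seq (fun n => un n t))).
  assert (Hclose : forall n t, Rabs (u t - un n t) <= q ^ n * (D / (1 - q))).
  { intros n t. apply (geometric_cauchy q D (fun n => un n t)); auto. }
  assert (Hlim : forall t, is_lim_seq (fun n => un n t) (u t)).
  { intros t. apply (geometric_cauchy q D (fun n => un n t)); auto. }
  pose proof (geometric_to_zero q (D / (1 - q)) Hq) as Hgeom.
  assert (HPu : P u).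
  { apply (Hclosed un); auto. intros eps Heps.
    apply is_lim_seq_spec in Hgeom. destruct (Hgeom (mkposreal eps Heps)) as [N HN].
    exists N. intros t. specialize (HN N (le_n N)). simpl in HN.
    apply Rabs_def2 in HN. specialize (Hclose N t). lra. }
  exists u. split; [exact HPu|]. intros t.
  assert (Hl : is_lim_seq (fun n => un (S n) t) (Phi u t)).
  { apply is_lim_seq_spec. intros eps.
    apply is_lim_seq_spec in Hgeom. destruct (Hgeom eps) as [N HN].
    exists N. intros n Hn. specialize (HN n Hn). apply Rabs_def2 in HN.
    pose proof (Hcontr (un n) u (q ^ n * (D / (1 - q))) (HPn n) HPu) as Hc.
    simpl. eapply Rle_lt_trans.
    - apply Hc. intros s. rewrite Rabs_minus_sym. apply Hclose.
    - assert (0 <= q ^ n * (D / (1 - q))).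
      { eapply Rle_trans; [apply Rabs_pos | apply (Hclose n t)]. }
      nra. }
  pose proof (Hlim t) as Hl'. apply is_lim_seq_incr_1 in Hl'.
  apply is_lim_seq_unique in Hl. apply is_lim_seq_unique in Hl'. rewrite Hl in Hl'.
  now inversion Hl'.
Qed.

(** * Decreasing nonlinearities with bounded slopes *)

(** The resolvent has uniform norm at most [1 / M]: compare [u] and [- u] with
    constants. *)
Lemma resolvent_bound T c M u u1 u2 d :
  0 < T -> 0 < M -> periodic T u -> jet2 u u1 u2 ->
  (forall t, Rabs (u2 t + c * u1 t - M * u t) <= M * d) ->
  forall t, Rabs (u t) <= d.
Proof.
  intros HT HM Hp Hj Hb.
  assert (Hside : forall a, a = 1 \/ a = -1 -> forall t, a * u t <= d).
  { intros a Ha t.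
    pose proof (jet2_comb a 0 _ _ _ _ _ _ 0 Hj Hj) as Hw.
    enough (a * u t + 0 * u t + 0 <= d + 0) by lra.
    revert t. refine (comparison T c 0 _ _ _ _ _ _ HT _ _ Hw (jet2_const d) _).
    - intros t. now rewrite Hp.
    - now intros t.
    - intros t Hpos. cbv beta in *. specialize (Hb t).
      apply Rabs_le_between in Hb. destruct Ha as [-> | ->]; nra. }
  intros t. apply Rabs_le. pose proof (Hside 1 (or_introl eq_refl) t).
  pose proof (Hside (-1) (or_intror eq_refl) t). lra.
Qed.

(** Adding [M * u] on both sides turns the equation into a fixed-point problem
    [u = S (f - H (u))] with [H x = G x + M * x]. The bounds on [G] make [H]
    Lipschitz with constant [M - m], the resolvent [S] has norm at most [1 / M],
    and the composite contracts with factor [(M - m) / M]. *)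
Lemma periodic_solution_bilipschitz T c m M G f :
  0 < T -> 0 < m ->
  (forall x y, x <= y -> m * (y - x) <= G x - G y <= M * (y - x)) ->
  (forall t, continuous f t) -> periodic T f ->
  exists u u1 u2, periodic T u /\ jet2 u u1 u2 /\
    forall t, u2 t + c * u1 t + G (u t) = f t.
Proof.
  intros HT Hm HG Hfc Hfp.
  assert (HmM : m <= M) by (specialize (HG 0 1); lra).
  destruct (resolvent_exists T c M HT ltac:(lra)) as [S HS].
  set (P := fun u : R -> R => periodic T u /\ forall t, continuous u t).
  set (H := fun x => G x + M * x).
  assert (HH : forall x y, Rabs (H x - H y) <= (M - m) * Rabs (x - y)).
  { intros x y. unfold H.
    destruct (Rle_or_lt x y) as [Hxy|Hxy].
    - specialize (HG x y Hxy). rewrite (Rabs_left1 (x - y)) by lra. apply Rabs_le. lra.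
    - specialize (HG y x ltac:(lra)). rewrite (Rabs_pos_eq (x - y)) by lra.
      apply Rabs_le. lra. }
  assert (HHc : forall x, continuous H x).
  { intros x. apply continuity_pt_filterlim. intros eps Heps.
    exists (eps / (M + 1)). split; [apply Rdiv_lt_0_compat; lra|].
    intros y [_ Hy]. simpl in *. unfold R_dist in *.
    eapply Rle_lt_trans; [apply HH|].
    apply (Rmult_lt_compat_r (M + 1)) in Hy; [|lra].
    unfold Rdiv in Hy. rewrite Rmult_assoc, Rinv_l in Hy by lra.
    pose proof (Rabs_pos (y - x)). nra. }
  set (F := fun (u : R -> R) t => f t - H (u t)).
  assert (HF : forall u, P u -> (forall t, continuous (F u) t) /\ periodic T (F u)).
  { intros u [Hp Hc]. split.
    - intros t. apply (continuous_minus f (fun t => H (u t))); [apply Hfc|].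
      apply (continuous_comp u H); auto.
    - intros t. unfold F. now rewrite Hp, Hfp. }
  assert (HPF : forall u, P u -> P (S (F u))).
  { intros u Hu. destruct (HF u Hu) as [Hc Hp].
    destruct (HS (F u) Hc Hp) as [Hp' (u1 & u2 & Hj & _)].
    split; [exact Hp'|]. intros t. eapply derive_continuous, (proj1 Hj). }
  assert (HP0 : P (fun _ => 0)).
  { split; [now intros t|]. intros t. apply continuous_const. }
  assert (Hbdd : exists D, forall t, Rabs (S (F (fun _ => 0)) t - 0) <= D).
  { destruct (HPF _ HP0) as [Hp Hc].
    destruct (periodic_bounded T _ HT Hp Hc) as [D [_ HD]].
    exists D. intros t. rewrite Rminus_0_r. apply HD. }
  destruct Hbdd as [D HD].
  destruct (contraction_fixed_point P (fun u => S (F u)) ((M - m) / M) D (fun _ => 0))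
    as [u [Hu Hfix]]; auto.
  - split.
    + apply Rmult_le_pos; [lra|]. left; apply Rinv_0_lt_compat; lra.
    + apply Rmult_lt_reg_r with M; [lra|]. unfold Rdiv.
      rewrite Rmult_assoc, Rinv_l by lra. lra.
  - intros u v d Hu Hv Hd.
    destruct (HF u Hu) as [Hcu Hpu]. destruct (HF v Hv) as [Hcv Hpv].
    destruct (HS _ Hcu Hpu) as [Hpu' (u1 & u2 & Hju & Equ)].
    destruct (HS _ Hcv Hpv) as [Hpv' (v1 & v2 & Hjv & Eqv)].
    pose proof (jet2_comb 1 (-1) _ _ _ _ _ _ 0 Hju Hjv) as Hw.
    intros t.
    replace (S (F u) t - S (F v) t) with (1 * S (F u) t + -1 * S (F v) t + 0) by ring.
    revert t. refine (resolvent_bound T c M _ _ _ _ HT _ _ Hw _); [lra | |].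
    + intros t. now rewrite Hpu', Hpv'.
    + intros t. cbv beta.
      replace (1 * u2 t + -1 * v2 t + c * (1 * u1 t + -1 * v1 t) -
               M * (1 * S (F u) t + -1 * S (F v) t + 0))
        with ((u2 t + c * u1 t - M * S (F u) t) - (v2 t + c * v1 t - M * S (F v) t)) by ring.
      rewrite Equ, Eqv. unfold F.
      replace (f t - H (u t) - (f t - H (v t))) with (H (v t) - H (u t)) by ring.
      eapply Rle_trans; [apply HH|]. rewrite Rabs_minus_sym.
      replace (M * ((M - m) / M * d)) with ((M - m) * d) by (field; lra).
      apply Rmult_le_compat_l; [lra | apply Hd].
  - intros un u Hun Hlim. split.
    + intros t. apply Rminus_diag_uniq.
      destruct (Req_dec (u (t + T) - u t) 0) as [|Hne]; [assumption | exfalso].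
      apply Rabs_pos_lt in Hne.
      destruct (Hlim (Rabs (u (t + T) - u t) / 4)) as [n Hn]; [lra|].
      pose proof (Hn t) as H1. pose proof (Hn (t + T)) as H2.
      rewrite (proj1 (Hun n)) in H2.
      assert (Rabs (u (t + T) - u t) <= Rabs (u (t + T) - un n t) + Rabs (u t - un n t)).
      { replace (u (t + T) - u t) with ((u (t + T) - un n t) - (u t - un n t)) by ring.
        eapply Rle_trans; [apply Rabs_triang|]. rewrite Rabs_Ropp. lra. }
      lra.
    + apply (uniform_limit_continuous un); auto. intros n; apply Hun.
  - destruct (HF u Hu) as [Hcu Hpu].
    destruct (HS _ Hcu Hpu) as [Hpu' (u1 & u2 & Hju & Equ)].
    exists (S (F u)), u1, u2. repeat split; auto; try apply Hju.
    intros t. specialize (Equ t). rewrite Hfix in Equ |- *.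
    change (F u t) with (f t - (G (u t) + M * u t)) in Equ. lra.
Qed.

(** * The singular nonlinearity *)

Definition sing (p x : R) : R := 1 / Rpower x p.
(** Minus the derivative of [sing p]. *)
Definition sing_slope (p x : R) : R := p * Rpower x (- p - 1).

Lemma sing_power p x : sing p x = Rpower x (- p).
Proof. unfold sing. rewrite Rpower_Ropp. apply Rmult_1_l. Qed.

Lemma sing_pos p x : 0 < sing p x.
Proof. rewrite sing_power. apply exp_pos. Qed.

Lemma sing_slope_pos p x : 0 < p -> 0 < sing_slope p x.
Proof. intros Hp. apply Rmult_lt_0_compat; [exact Hp | apply exp_pos]. Qed.

Lemma Rpower_neg_le q x y : 0 <= q -> 0 < x <= y -> Rpower y (- q) <= Rpower x (- q).
Proof.
  intros Hq Hxy. rewrite !Rpower_Ropp.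
  apply Rinv_le_contravar; [apply exp_pos | now apply Rle_Rpower_l].
Qed.

Lemma sing_slope_le p x y : 0 < p -> 0 < x <= y -> sing_slope p y <= sing_slope p x.
Proof.
  intros Hp Hxy. apply Rmult_le_compat_l; [lra|].
  replace (- p - 1) with (- (p + 1)) by ring. apply Rpower_neg_le; lra.
Qed.

Lemma sing_derive p x : 0 < x -> is_derive (sing p) x (- sing_slope p x).
Proof.
  intros Hx. apply (is_derive_ext (fun y => Rpower y (- p))).
  - intros y. now rewrite sing_power.
  - apply is_derive_Reals. unfold sing_slope. rewrite Ropp_mult_distr_l.
    now apply derivable_pt_lim_power.
Qed.

(** The mean value theorem; the slope decreases, so its extreme values on an
    interval are those at the end points. *)
Lemma sing_bilipschitz p a b x y :
  0 < p -> 0 < a <= x -> x <= y <= b ->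
  sing_slope p b * (y - x) <= sing p x - sing p y <= sing_slope p a * (y - x).
Proof.
  intros Hp Hax Hyb. destruct (Req_dec x y) as [->|Hne].
  - rewrite !Rminus_diag, !Rmult_0_r. lra.
  - destruct (MVT_cor2 (sing p) (fun z => - sing_slope p z) x y) as [z [Hz Hxyz]]; [lra| |].
    + intros z Hz. apply is_derive_Reals, sing_derive. lra.
    + pose proof (sing_slope_le p a z Hp ltac:(lra)). pose proof (sing_slope_le p z b Hp ltac:(lra)).
      replace (sing p x - sing p y) with (sing_slope p z * (y - x)) by lra.
      split; apply Rmult_le_compat_r; lra.
Qed.

Lemma sing_decreasing p x y : 0 < p -> 0 < x < y -> sing p y < sing p x.
Proof.
  intros Hp Hxy.
  pose proof (sing_bilipschitz p x y x y Hp ltac:(lra) ltac:(lra)).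
  pose proof (sing_slope_pos p y Hp). nra.
Qed.

Lemma sing_nonincreasing p x y : 0 < p -> 0 < x <= y -> sing p y <= sing p x.
Proof. intros Hp Hxy. rewrite !sing_power. apply Rpower_neg_le; lra. Qed.

Lemma sing_root p y : 0 < p -> 0 < y -> sing p (Rpower y (- / p)) = y.
Proof.
  intros Hp Hy. rewrite sing_power, Rpower_mult.
  replace (- / p * - p) with 1 by (field; lra). now apply Rpower_1.
Qed.

Lemma root_sing p x : 0 < p -> 0 < x -> Rpower (sing p x) (- / p) = x.
Proof.
  intros Hp Hx. rewrite sing_power, Rpower_mult.
  replace (- p * - / p) with 1 by (field; lra). now apply Rpower_1.
Qed.

(** * Existence and comparison of positive solutions *)

Lemma solution_jet T p c e mu u :
  positive_periodic_solution T p c e mu u ->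
  periodic T u /\ jet2 u (Derive u) (Derive (Derive u)) /\ (forall t, 0 < u t) /\
  forall t, Derive (Derive u) t + c * Derive u t + sing p (u t) = mu + e t.
Proof.
  intros ((H1 & H2 & _) & Hp & Hpos & Heq).
  split; [exact Hp|]. split; [|now split].
  split; intros t; now apply Derive_correct.
Qed.

Lemma solution_of_jet T p c e mu u u1 u2 :
  (forall t, continuous e t) ->
  periodic T u -> jet2 u u1 u2 -> (forall t, 0 < u t) ->
  (forall t, u2 t + c * u1 t + sing p (u t) = mu + e t) ->
  positive_periodic_solution T p c e mu u.
Proof.
  intros He Hp [H1 H2] Hpos Heq.
  assert (E1 : Derive u = u1).
  { apply functional_extensionality. intros t. apply is_derive_unique, H1. }
  assert (E2 : Derive (Derive u) = u2).
  { rewrite E1. apply functional_extensionality. intros t. apply is_derive_unique, H2. }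
  split; [split; [|split] |split; [|split]]; auto.
  - intros t. now exists (u1 t).
  - intros t. rewrite E1. now exists (u2 t).
  - intros t. rewrite E2.
    apply (continuous_ext (fun s => mu + e s - c * u1 s - sing p (u s))).
    { intros s. specialize (Heq s). simpl. lra. }
    apply (continuous_minus (fun s => mu + e s - c * u1 s) (fun s => sing p (u s))).
    + apply (continuous_minus (fun s => mu + e s) (fun s => c * u1 s)).
      * apply (continuous_plus (fun _ => mu) e); [apply continuous_const | apply He].
      * apply (continuous_mult (fun _ => c) u1); [apply continuous_const|].
        eapply derive_continuous, H2.
    + apply (continuous_comp u (sing p)).
      * eapply derive_continuous, H1.
      * eapply derive_continuous, sing_derive, Hpos.
  - intros t. rewrite E2, E1. apply Heq.
Qed.

Lemma solution_continuous T p c e mu u :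
  positive_periodic_solution T p c e mu u -> forall t, continuous u t.
Proof.
  intros Hu t. destruct (solution_jet _ _ _ _ _ _ Hu) as (_ & [H _] & _).
  eapply derive_continuous, H.
Qed.

Section Problem.

Variables (T p c : R) (e : R -> R).
Hypothesis HT : 0 < T.
Hypothesis Hp : 0 < p.
Hypothesis He : forall t, continuous e t.
Hypothesis Hper : periodic T e.
Hypothesis Hmean : RInt e 0 T = 0.

Notation sol := (positive_periodic_solution T p c e).

(** If [mu <= 0] then [u'' + c u' < e] everywhere, while [E'' + c E' = e]. The
    comparison then holds with every additive constant, which is absurd. *)
Lemma solution_mu_pos mu u : sol mu u -> 0 < mu.
Proof.
  intros Hu. destruct (solution_jet _ _ _ _ _ _ Hu) as (Hpu & Hju & Hpos & Heq).
  destruct (periodic_solution_no_zero_order T c e HT He Hper Hmean)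
    as (E & E1 & E2 & HpE & HjE & HeqE).
  destruct (Rlt_or_le 0 mu) as [|Hmu]; [assumption | exfalso].
  assert (H : E 0 <= u 0 + (E 0 - u 0 - 1)); [|lra].
  generalize 0 at 1 2. refine (comparison T c _ _ _ _ _ _ _ HT HpE Hpu HjE Hju _).
  intros t _. specialize (Heq t). specialize (HeqE t).
  pose proof (sing_pos p (u t)). lra.
Qed.

(** Lower and upper solutions. A small constant [alpha] is a lower solution
    because the singular term dominates there; [E + K] with [E'' + c E' = e] and
    [K] large is an upper solution because the singular term falls below [mu].
    The singular term is replaced outside the interval [[alpha, b]] containing
    their values by affine functions of negative slope; comparison shows that
    the solution of the modified equation never leaves that interval. *)
Lemma solution_exists mu : 0 < mu -> exists u, sol mu u.
Proof.
  intros Hmu.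
  destruct (periodic_solution_no_zero_order T c e HT He Hper Hmean)
    as (E & E1 & E2 & HpE & HjE & HeqE).
  destruct (periodic_bounded T e HT Hper He) as (be & Hbe & Hebd).
  destruct (periodic_bounded T E HT HpE) as (bE & HbE & HEbd).
  { intros t. eapply derive_continuous, (proj1 HjE). }
  set (alpha := Rpower (mu + be) (- / p)).
  set (gamma := Rpower mu (- / p)).
  assert (Halpha : 0 < alpha) by apply exp_pos.
  assert (Hgamma : alpha <= gamma).
  { apply Rpower_neg_le; [|lra]. left. now apply Rinv_0_lt_compat. }
  set (b := gamma + 2 * bE).
  set (cl := fun x => Rmax alpha (Rmin x b)).
  set (k := sing_slope p b).
  assert (Hk : 0 < k) by now apply sing_slope_pos.
  assert (HkM : k <= sing_slope p alpha) by (apply sing_slope_le; unfold b; lra).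
  set (G := fun x => sing p (cl x) - k * (x - cl x)).
  assert (Hcl : forall x, alpha <= cl x <= b).
  { intros x. unfold cl. assert (alpha <= b) by (unfold b; lra).
    split; [apply Rmax_l|]. apply Rmax_lub; [lra | apply Rmin_r]. }
  assert (HclL : forall x y, x <= y -> 0 <= cl y - cl x <= y - x).
  { intros x y Hxy. unfold cl, Rmax, Rmin.
    repeat destruct Rle_dec; lra. }
  assert (HGin : forall x, alpha <= x <= b -> G x = sing p x).
  { intros x Hx. unfold G. replace (cl x) with x; [ring|].
    unfold cl. rewrite Rmin_left, Rmax_right; lra. }
  assert (HG : forall x y, x <= y ->
            k * (y - x) <= G x - G y <= sing_slope p alpha * (y - x)).
  { intros x y Hxy. pose proof (HclL x y Hxy). pose proof (Hcl x). pose proof (Hcl y).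
    pose proof (sing_bilipschitz p alpha b (cl x) (cl y) Hp ltac:(lra) ltac:(lra)).
    fold k in H2. unfold G. split; [lra|].
    assert (0 <= (sing_slope p alpha - k) * ((y - x) - (cl y - cl x))) by (apply Rmult_le_pos; lra).
    lra. }
  assert (HGlt : forall x y, x < y -> G y < G x).
  { intros x y Hxy. specialize (HG x y ltac:(lra)).
    assert (0 < k * (y - x)) by (apply Rmult_lt_0_compat; lra). lra. }
  destruct (periodic_solution_bilipschitz T c k (sing_slope p alpha) G (fun t => mu + e t))
    as (u & u1 & u2 & Hpu & Hju & Heq); auto.
  { intros t. apply (continuous_plus (fun _ => mu) e); [apply continuous_const | apply He]. }
  { intros t. now rewrite Hper. }
  (* alpha is a lower solution: sing p alpha = mu + be >= mu + e t. *)
  assert (Hlow : forall t, alpha <= u t + 0).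
  { refine (comparison T c 0 _ _ _ _ _ _ HT _ Hpu (jet2_const alpha) Hju _).
    - now intros t.
    - intros t Hlt. specialize (Heq t). specialize (HGlt (u t) alpha ltac:(lra)).
      rewrite (HGin alpha) in HGlt by (unfold b; lra).
      unfold alpha in HGlt at 1. rewrite sing_root in HGlt by lra.
      specialize (Hebd t). apply Rabs_le_between in Hebd. lra. }
  (* E + gamma + bE stays in [gamma, b], where the singular term is at most mu. *)
  assert (Hup : forall t, u t <= E t + (gamma + bE)).
  { refine (comparison T c _ _ _ _ _ _ _ HT Hpu HpE Hju HjE _).
    intros t Hlt. specialize (Heq t). specialize (HGlt _ _ Hlt).
    specialize (HEbd t). apply Rabs_le_between in HEbd.
    rewrite (HGin (E t + (gamma + bE))) in HGlt by (unfold b; lra).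
    assert (sing p (E t + (gamma + bE)) <= mu).
    { rewrite <- (sing_root p mu) by lra. apply sing_nonincreasing; [lra|].
      fold gamma. lra. }
    specialize (HeqE t). lra. }
  exists u. apply (solution_of_jet T p c e mu u u1 u2); auto.
  - intros t. specialize (Hlow t). lra.
  - intros t. rewrite <- Heq. f_equal. symmetry. apply HGin.
    specialize (Hlow t). specialize (Hup t).
    specialize (HEbd t). apply Rabs_le_between in HEbd. unfold b. lra.
Qed.

Lemma solution_antitone mu1 mu2 u1 u2 :
  mu1 <= mu2 -> sol mu1 u1 -> sol mu2 u2 -> forall t, u2 t <= u1 t.
Proof.
  intros Hmu H1 H2.
  destruct (solution_jet _ _ _ _ _ _ H1) as (Hp1 & Hj1 & Hpos1 & Heq1).
  destruct (solution_jet _ _ _ _ _ _ H2) as (Hp2 & Hj2 & Hpos2 & Heq2).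
  enough (H : forall t, u2 t <= u1 t + 0) by (intros t; specialize (H t); lra).
  refine (comparison T c _ _ _ _ _ _ _ HT Hp2 Hp1 Hj2 Hj1 _).
  intros t Hlt. specialize (Heq1 t). specialize (Heq2 t).
  pose proof (sing_decreasing p (u1 t) (u2 t) Hp ltac:(specialize (Hpos1 t); lra)). lra.
Qed.

Lemma solution_unique mu u1 u2 : sol mu u1 -> sol mu u2 -> u1 = u2.
Proof.
  intros H1 H2. apply functional_extensionality. intros t.
  apply Rle_antisym; eapply solution_antitone; eauto; lra.
Qed.

(** The gap is what makes the averages strictly ordered. A downward shift of [u1]
    by [d] stays above [u2] as long as [d] changes the singular term, near the
    values of [u2], by at most [mu2 - mu1]; the minimum of [u2] supplies a
    Lipschitz constant. *)
Lemma solution_strict_gap mu1 mu2 u1 u2 :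
  mu1 < mu2 -> sol mu1 u1 -> sol mu2 u2 ->
  exists d, 0 < d /\ forall t, u2 t + d <= u1 t.
Proof.
  intros Hmu H1 H2.
  destruct (solution_jet _ _ _ _ _ _ H1) as (Hp1 & Hj1 & Hpos1 & Heq1).
  destruct (solution_jet _ _ _ _ _ _ H2) as (Hp2 & Hj2 & Hpos2 & Heq2).
  destruct (periodic_max T (fun t => - u2 t) HT) as [t0 Ht0].
  { intros t. now rewrite Hp2. }
  { intros t. apply (continuous_opp u2). eapply solution_continuous; eauto. }
  (* u2 t0 is the minimum of u2, so M bounds the slope at and above all values of u2. *)
  set (M := sing_slope p (u2 t0)).
  assert (HM : 0 < M) by now apply sing_slope_pos.
  exists ((mu2 - mu1) / M).
  assert (Hd : 0 < (mu2 - mu1) / M) by (apply Rdiv_lt_0_compat; lra).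
  split; [exact Hd|].
  enough (H : forall t, u2 t <= u1 t + - ((mu2 - mu1) / M))
    by (intros t; specialize (H t); lra).
  refine (comparison T c _ _ _ _ _ _ _ HT Hp2 Hp1 Hj2 Hj1 _).
  intros t Hlt. specialize (Heq1 t). specialize (Heq2 t). specialize (Ht0 t).
  simpl in Ht0. set (d := (mu2 - mu1) / M) in *.
  assert (HMd : M * d = mu2 - mu1) by (unfold d; field; lra).
  pose proof (sing_decreasing p (u1 t) (u2 t + d) Hp ltac:(specialize (Hpos1 t); lra)).
  pose proof (sing_bilipschitz p (u2 t0) (u2 t + d) (u2 t) (u2 t + d) Hp
                ltac:(specialize (Hpos2 t0); lra) ltac:(lra)) as [_ Hs].
  fold M in Hs. replace (u2 t + d - u2 t) with d in Hs by ring. lra.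
Qed.

(** By monotonicity in [mu], every solution with parameter at least [lo] lies below
    the maximum of the solution at [lo]. The slope of the singular term at that
    maximum is a uniform rate of decrease, and [L] is its inverse. *)
Lemma solution_lipschitz lo :
  0 < lo -> exists L, 0 < L /\ forall mu1 mu2 u1 u2,
    lo <= mu1 <= mu2 -> sol mu1 u1 -> sol mu2 u2 ->
    forall t, u1 t <= u2 t + L * (mu2 - mu1).
Proof.
  intros Hlo. destruct (solution_exists lo Hlo) as [u0 H0].
  destruct (solution_jet _ _ _ _ _ _ H0) as (Hp0 & _ & Hpos0 & _).
  destruct (periodic_max T u0 HT Hp0 (solution_continuous _ _ _ _ _ _ H0)) as [t0 Ht0].
  set (m := sing_slope p (u0 t0)).
  assert (Hm : 0 < m) by now apply sing_slope_pos.
  exists (/ m). split; [now apply Rinv_0_lt_compat|].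
  intros mu1 mu2 u1 u2 Hmu H1 H2.
  pose proof (solution_antitone lo mu1 u0 u1 ltac:(lra) H0 H1) as H01.
  destruct (solution_jet _ _ _ _ _ _ H1) as (Hp1 & Hj1 & Hpos1 & Heq1).
  destruct (solution_jet _ _ _ _ _ _ H2) as (Hp2 & Hj2 & Hpos2 & Heq2).
  refine (comparison T c _ _ _ _ _ _ _ HT Hp1 Hp2 Hj1 Hj2 _).
  intros t Hlt. specialize (Heq1 t). specialize (Heq2 t).
  specialize (Ht0 t). specialize (H01 t). specialize (Hpos2 t).
  assert (0 <= / m * (mu2 - mu1)).
  { apply Rmult_le_pos; [left; now apply Rinv_0_lt_compat | lra]. }
  pose proof (sing_bilipschitz p (u2 t) (u0 t0) (u2 t) (u1 t) Hp ltac:(lra) ltac:(lra))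
    as [Hs _]. fold m in Hs.
  assert (m * (/ m * (mu2 - mu1)) < m * (u1 t - u2 t)) by (apply Rmult_lt_compat_l; lra).
  rewrite <- Rmult_assoc, Rinv_r in H3 by lra. lra.
Qed.

(** [E + k] lies below the solution for every constant [k] that keeps its values
    below [Rpower mu (- / p)], the point where the singular term equals [mu]. The
    constant [C] bounds the oscillation of [E] and does not depend on [mu], which
    makes solutions large as [mu] tends to 0. *)
Lemma solution_lower_bound :
  exists C, 0 <= C /\ forall mu u, sol mu u -> forall t, Rpower mu (- / p) - C <= u t.
Proof.
  destruct (periodic_solution_no_zero_order T c e HT He Hper Hmean)
    as (E & E1 & E2 & HpE & HjE & HeqE).
  destruct (periodic_bounded T E HT HpE) as (bE & HbE & HEbd).
  { intros t. eapply derive_continuous, (proj1 HjE). }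
  exists (2 * bE). split; [lra|]. intros mu u Hu t.
  pose proof (solution_mu_pos mu u Hu) as Hmu.
  destruct (solution_jet _ _ _ _ _ _ Hu) as (Hpu & Hju & Hpos & Heq).
  assert (H : E t <= u t + (bE - Rpower mu (- / p))).
  { revert t. refine (comparison T c _ _ _ _ _ _ _ HT HpE Hpu HjE Hju _).
    intros t Hlt. specialize (Heq t). specialize (HeqE t).
    specialize (HEbd t). apply Rabs_le_between in HEbd. specialize (Hpos t).
    pose proof (sing_decreasing p (u t) (Rpower mu (- / p)) Hp ltac:(lra)) as Hs.
    rewrite sing_root in Hs by lra. lra. }
  specialize (HEbd t). apply Rabs_le_between in HEbd. lra.
Qed.

(** The constant [eps] is an upper solution once [mu + e] dominates
    [sing p eps]. *)
Lemma solution_small eps :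
  0 < eps -> exists mu, 0 < mu /\ forall u, sol mu u -> forall t, u t <= eps.
Proof.
  intros Heps. destruct (periodic_bounded T e HT Hper He) as (be & Hbe & Hebd).
  pose proof (sing_pos p eps) as Hs.
  exists (sing p eps + be). split; [lra|]. intros u Hu.
  destruct (solution_jet _ _ _ _ _ _ Hu) as (Hpu & Hju & Hpos & Heq).
  enough (H : forall t, u t <= eps + 0) by (intros t; specialize (H t); lra).
  refine (comparison T c 0 _ _ _ _ _ _ HT Hpu _ Hju (jet2_const eps) _).
  - now intros t.
  - intros t Hlt. specialize (Heq t). specialize (Hebd t). apply Rabs_le_between in Hebd.
    pose proof (sing_decreasing p eps (u t) Hp ltac:(lra)). lra.
Qed.

End Problem.

(** * Averages of solutions *)

Lemma average_le T u v k :
  0 < T -> (forall t, continuous u t) -> (forall t, continuous v t) ->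
  (forall t, u t <= v t + k) -> average T u <= average T v + k.
Proof.
  intros HT Hu Hv Hle. unfold average.
  assert (H : RInt u 0 T <= RInt v 0 T + T * k).
  { replace (RInt v 0 T + T * k) with (RInt (fun t => v t + k) 0 T).
    - apply RInt_le; [lra | now apply continuous_ex_RInt | | auto].
      apply continuous_ex_RInt. intros t.
      apply (continuous_plus v (fun _ => k)); [apply Hv | apply continuous_const].
    - rewrite (RInt_plus v (fun _ => k)).
      + rewrite RInt_const. unfold plus, scal; simpl. unfold mult; simpl. ring.
      + now apply continuous_ex_RInt.
      + apply ex_RInt_const. }
  replace (1 / T * RInt v 0 T + k) with (1 / T * (RInt v 0 T + T * k)) by (field; lra).
  apply Rmult_le_compat_l; [|exact H].
  left. apply Rdiv_lt_0_compat; lra.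
Qed.

Lemma average_const T k : 0 < T -> average T (fun _ => k) = k.
Proof.
  intros HT. unfold average. rewrite RInt_const.
  unfold scal; simpl; unfold mult; simpl. field. lra.
Qed.

Lemma mean_decomposition_average T u xi :
  0 < T -> (forall t, continuous u t) ->
  ((exists U, mean_decomposition T u xi U) <-> xi = average T u).
Proof.
  intros HT Hu.
  assert (Hc : is_RInt (fun _ => xi) 0 T (T * xi)).
  { replace (T * xi) with (scal (T - 0) xi); [apply (is_RInt_const (V := R_NormedModule))|].
    unfold scal; simpl; unfold mult; simpl. ring. }
  split.
  - intros (U & HU & HI). unfold average.
    assert (H : is_RInt u 0 T (T * xi)).
    { apply (is_RInt_ext (fun t => plus xi (U t))).
      - intros t _. now rewrite HU.
      - rewrite <- (Rplus_0_r (T * xi)). now apply (is_RInt_plus (fun _ => xi) U). }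
    rewrite (is_RInt_unique _ _ _ _ H). field. lra.
  - intros Hxi. exists (fun t => u t - xi). split; [intros t; lra|].
    assert (H : is_RInt (fun t => u t - xi) 0 T (RInt u 0 T - T * xi)).
    { apply (is_RInt_minus u (fun _ => xi)); [|exact Hc].
      apply (RInt_correct (V := R_CompleteNormedModule)). now apply continuous_ex_RInt. }
    replace (RInt u 0 T - T * xi) with 0 in H; [exact H|].
    rewrite Hxi. unfold average. simpl. field. lra.
Qed.

(** * The solution curve *)

(** A decreasing function onto an interval has no room for jumps, and its limits at
    the ends are the ends of the range. *)
Lemma decreasing_bijection_limits (phi : R -> R) :
  (forall x y, 0 < x -> x < y -> phi y < phi x) ->
  (forall x, 0 < x -> 0 < phi x) ->
  (forall y, 0 < y -> exists x, 0 < x /\ phi x = y) ->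
  (forall x, 0 < x -> continuous phi x) /\
  filterlim phi (at_right 0) (Rbar_locally p_infty) /\ is_lim phi p_infty 0.
Proof.
  intros Hdec Hpos Honto.
  assert (Hrev : forall x y, 0 < x -> 0 < y -> phi y < phi x -> x < y).
  { intros x y Hx Hy H. destruct (Rtotal_order x y) as [|[->|Hlt]]; [assumption|lra|].
    specialize (Hdec y x Hy Hlt). lra. }
  split; [|split].
  - intros x Hx. apply continuity_pt_filterlim. intros eps Heps.
    pose proof (Hpos x Hx).
    set (d := Rmin eps (phi x / 2)).
    assert (Hd : 0 < d <= eps /\ d < phi x).
    { unfold d, Rmin. destruct Rle_dec; lra. }
    destruct (Honto (phi x + d)) as (x1 & Hx1 & E1); [lra|].
    destruct (Honto (phi x - d)) as (x2 & Hx2 & E2); [lra|].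
    assert (x1 < x) by (apply Hrev; lra). assert (x < x2) by (apply Hrev; lra).
    exists (Rmin (x - x1) (x2 - x)). split; [apply Rmin_pos; lra|].
    intros y [_ Hy]. simpl in *. unfold R_dist in *. apply Rabs_def2 in Hy.
    pose proof (Rmin_l (x - x1) (x2 - x)). pose proof (Rmin_r (x - x1) (x2 - x)).
    pose proof (Hdec x1 y Hx1 ltac:(lra)). pose proof (Hdec y x2 ltac:(lra) ltac:(lra)).
    apply Rabs_def1; lra.
  - intros Q [M HM]. unfold filtermap, at_right, within.
    destruct (Honto (Rmax M 1)) as (x & Hx & E).
    { pose proof (Rmax_r M 1). lra. }
    exists (mkposreal x Hx). intros y Hy Hy0. apply HM.
    unfold ball in Hy; simpl in Hy. unfold AbsRing_ball, abs, minus, plus, opp in Hy.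
    simpl in Hy. apply Rabs_def2 in Hy.
    pose proof (Hdec y x Hy0 ltac:(lra)). pose proof (Rmax_l M 1). lra.
  - apply is_lim_spec. intros eps. destruct (Honto eps (cond_pos eps)) as (x & Hx & E).
    exists x. intros y Hy. pose proof (Hdec x y Hx Hy). pose proof (Hpos y ltac:(lra)).
    rewrite Rminus_0_r, Rabs_pos_eq; lra.
Qed.

Lemma average_lt_of_mu_lt T p c e mu1 mu2 u1 u2 :
  0 < T -> 0 < p -> mu1 < mu2 ->
  positive_periodic_solution T p c e mu1 u1 ->
  positive_periodic_solution T p c e mu2 u2 ->
  average T u2 < average T u1.
Proof.
  intros HT Hp Hmu H1 H2.
  destruct (solution_strict_gap T p c e HT Hp mu1 mu2 u1 u2 Hmu H1 H2) as (d & Hd & Hgap).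
  enough (average T u2 <= average T u1 + - d) by lra.
  apply average_le; try (eapply solution_continuous; eassumption); [exact HT|].
  intros t. specialize (Hgap t). lra.
Qed.

Lemma average_unique T p c e mu1 mu2 u1 u2 :
  0 < T -> 0 < p ->
  positive_periodic_solution T p c e mu1 u1 ->
  positive_periodic_solution T p c e mu2 u2 ->
  average T u1 = average T u2 -> u1 = u2 /\ mu1 = mu2.
Proof.
  intros HT Hp H1 H2 Heq.
  destruct (Rtotal_order mu1 mu2) as [Hlt|[Hmu|Hgt]].
  - pose proof (average_lt_of_mu_lt T p c e _ _ _ _ HT Hp Hlt H1 H2). lra.
  - subst mu2. split; [|reflexivity]. now apply (solution_unique T p c e HT Hp mu1).
  - pose proof (average_lt_of_mu_lt T p c e _ _ _ _ HT Hp Hgt H2 H1). lra.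
Qed.

Lemma average_pos T p c e mu u :
  0 < T -> positive_periodic_solution T p c e mu u -> 0 < average T u.
Proof.
  intros HT Hu. destruct (solution_jet _ _ _ _ _ _ Hu) as (Hpu & Hju & Hpos & Heq).
  destruct (periodic_max T (fun t => - u t) HT) as [t0 Ht0].
  { intros t. now rewrite Hpu. }
  { intros t. apply (continuous_opp u). eapply solution_continuous; eauto. }
  enough (average T (fun _ => u t0) <= average T u + 0).
  { rewrite average_const in H by lra. specialize (Hpos t0). lra. }
  apply average_le; [lra | intros; apply continuous_const | |].
  - eapply solution_continuous; eauto.
  - intros t. specialize (Ht0 t). lra.
Qed.

(** The averages of the solutions depend on [mu] continuously, exceed [xi] for small
    [mu] and fall below [xi] for large [mu], so the intermediate value theorem
    applies. *)
Lemma average_onto T p c e xi :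
  0 < T -> 0 < p ->
  (forall t, continuous e t) -> periodic T e -> RInt e 0 T = 0 -> 0 < xi ->
  exists mu u, positive_periodic_solution T p c e mu u /\ average T u = xi.
Proof.
  intros HT Hp He Hper Hmean Hxi.
  set (sol := positive_periodic_solution T p c e).
  assert (Hfam : exists u : R -> R -> R, forall mu, 0 < mu -> sol mu (u mu)).
  { exists (fun mu => epsilon (inhabits (fun _ => 0)) (sol mu)).
    intros mu Hmu. apply epsilon_spec. now apply solution_exists. }
  destruct Hfam as [u Hu].
  assert (Hc : forall mu, 0 < mu -> forall t, continuous (u mu) t).
  { intros mu Hmu. eapply solution_continuous, Hu, Hmu. }
  set (A := fun mu => average T (u mu)).
  destruct (solution_lower_bound T p c e HT Hp He Hper Hmean) as (C & HC & Hlow).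
  (* At this parameter the lower bound Rpower lo (- / p) - C equals xi + 1. *)
  set (lo := sing p (xi + C + 1)).
  assert (Hlo : 0 < lo) by apply sing_pos.
  assert (HAlo : xi < A lo).
  { enough (average T (fun _ => xi + 1) <= A lo + 0).
    { rewrite average_const in H by lra. lra. }
    apply average_le; auto; [intros; apply continuous_const|].
    intros t. specialize (Hlow lo (u lo) (Hu lo Hlo) t).
    unfold lo in Hlow at 1. rewrite root_sing in Hlow by lra. lra. }
  destruct (solution_small T p c e HT Hp He Hper (xi / 2)) as (hi & Hhi & Hsmall);
    [lra|].
  assert (HAhi : A hi < xi).
  { enough (A hi <= average T (fun _ => xi / 2) + 0).
    { rewrite average_const in H by lra. lra. }
    apply average_le; auto; [intros; apply continuous_const|].
    intros t. specialize (Hsmall (u hi) (Hu hi Hhi) t). lra. }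
  assert (Hdec : forall a b, 0 < a -> a < b -> A b < A a).
  { intros a b Ha Hab. apply (average_lt_of_mu_lt T p c e a b); auto; apply Hu; lra. }
  assert (Hlohi : lo < hi).
  { destruct (Rtotal_order lo hi) as [|[<-|H]]; [assumption|lra|].
    specialize (Hdec hi lo Hhi H). lra. }
  destruct (solution_lipschitz T p c e HT Hp He Hper Hmean (lo / 2))
    as (L & HL & HLip); [lra|].
  assert (HALip : forall a b, lo / 2 <= a <= b -> A b <= A a <= A b + L * (b - a)).
  { intros a b Hab. split.
    - destruct (Req_dec a b) as [->|]; [lra|]. left. apply Hdec; lra.
    - apply average_le; auto; try (apply Hc; lra).
      apply (HLip a b); auto; apply Hu; lra. }
  destruct (IVT_interv (fun mu => xi - A mu) lo hi) as (mu & Hmu & Heq); try lra.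
  - intros a Ha eps Heps. exists (Rmin (lo / 2) (eps / (L + 1))).
    split. { apply Rmin_pos; [lra|]. apply Rdiv_lt_0_compat; lra. }
    intros b [_ Hb]. simpl in *. unfold R_dist in *.
    pose proof (Rmin_l (lo / 2) (eps / (L + 1))). pose proof (Rmin_r (lo / 2) (eps / (L + 1))).
    assert (Hb' : Rabs (b - a) < eps / (L + 1)) by lra.
    apply Rabs_def2 in Hb.
    apply (Rmult_lt_compat_l (L + 1)) in Hb'; [|lra].
    replace ((L + 1) * (eps / (L + 1))) with eps in Hb' by (field; lra).
    destruct (Rle_or_lt a b) as [Hab|Hab].
    + rewrite Rabs_pos_eq in Hb' by lra. specialize (HALip a b ltac:(lra)).
      apply Rabs_def1; lra.
    + rewrite Rabs_left in Hb' by lra. specialize (HALip b a ltac:(lra)).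
      apply Rabs_def1; lra.
  - exists mu, (u mu). split; [apply Hu; lra|]. unfold A in Heq. lra.
Qed.

Theorem theorem4p1 :
  forall (T p c : R) (e : R -> R),
    0 < T -> 0 < p ->
    (forall t, continuous e t) -> periodic T e -> RInt e 0 T = 0 ->
    (forall mu,
       (exists! u, positive_periodic_solution T p c e mu u) <-> 0 < mu) /\
    (forall mu u, positive_periodic_solution T p c e mu u ->
       forall xi, (exists U, mean_decomposition T u xi U) <-> xi = average T u) /\
    (forall mu1 u1 mu2 u2,
       positive_periodic_solution T p c e mu1 u1 ->
       positive_periodic_solution T p c e mu2 u2 ->
       average T u1 = average T u2 -> u1 = u2 /\ mu1 = mu2) /\
    (exists phi : R -> R,
       (forall xi mu,
          (exists u, positive_periodic_solution T p c e mu u /\ average T u = xi)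
          <-> 0 < xi /\ mu = phi xi) /\
       (forall psi : R -> R,
          (forall mu u, positive_periodic_solution T p c e mu u ->
             mu = psi (average T u)) ->
          forall xi, 0 < xi -> psi xi = phi xi) /\
       (forall xi, 0 < xi -> continuous phi xi) /\
       (forall xi1 xi2, 0 < xi1 -> xi1 < xi2 -> phi xi2 < phi xi1) /\
       filterlim phi (at_right 0) (Rbar_locally p_infty) /\
       is_lim phi p_infty 0).
Proof.
  intros T p c e HT Hp He Hper Hmean.
  split; [|split; [|split]].
  - intros mu. split.
    + intros (u & Hu & _). exact (solution_mu_pos T p c e HT He Hper Hmean mu u Hu).
    + intros Hmu. destruct (solution_exists T p c e HT Hp He Hper Hmean mu Hmu) as [u Hu].
      exists u. split; [exact Hu|]. intros v Hv.
      now apply (solution_unique T p c e HT Hp mu).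
  - intros mu u Hu xi. apply mean_decomposition_average; [exact HT|].
    eapply solution_continuous, Hu.
  - intros mu1 u1 mu2 u2. now apply average_unique.
  - set (phi := fun xi => epsilon (inhabits 0) (fun mu =>
              exists u, positive_periodic_solution T p c e mu u /\ average T u = xi)).
    assert (Hphi : forall xi, 0 < xi -> exists u,
               positive_periodic_solution T p c e (phi xi) u /\ average T u = xi).
    { intros xi Hxi. unfold phi. apply epsilon_spec. now apply average_onto. }
    assert (Hdec : forall xi1 xi2, 0 < xi1 -> xi1 < xi2 -> phi xi2 < phi xi1).
    { intros x1 x2 Hx1 Hx. destruct (Hphi x1 Hx1) as (u1 & H1 & E1).
      destruct (Hphi x2 ltac:(lra)) as (u2 & H2 & E2).
      destruct (Rtotal_order (phi x2) (phi x1)) as [|[Heq|Hlt]]; [assumption| |].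
      - rewrite Heq in H2.
        rewrite (solution_unique T p c e HT Hp _ _ _ H1 H2) in E1. lra.
      - pose proof (average_lt_of_mu_lt T p c e _ _ _ _ HT Hp Hlt H1 H2). lra. }
    assert (Hgraph : forall xi mu,
       (exists u, positive_periodic_solution T p c e mu u /\ average T u = xi)
        <-> 0 < xi /\ mu = phi xi).
    { intros xi mu. split.
      - intros (u & Hu & <-). pose proof (average_pos T p c e mu u HT Hu) as Hx.
        split; [exact Hx|]. destruct (Hphi _ Hx) as (v & Hv & Ev).
        symmetry. now apply (average_unique T p c e _ _ v u).
      - intros [Hx ->]. auto. }
    destruct (decreasing_bijection_limits phi Hdec) as (Hcont & Hlim0 & Hlim).
    + intros xi Hx. destruct (Hphi xi Hx) as (u & Hu & _).
      exact (solution_mu_pos T p c e HT He Hper Hmean _ u Hu).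
    + intros mu Hmu. destruct (solution_exists T p c e HT Hp He Hper Hmean mu Hmu) as [u Hu].
      exists (average T u). destruct (proj1 (Hgraph (average T u) mu)) as [Hx Hm].
      * now exists u.
      * now split.
    + exists phi. split; [exact Hgraph|]. split; [|now repeat split].
      intros psi Hpsi xi Hx. destruct (Hphi xi Hx) as (u & Hu & <-).
      symmetry. now apply Hpsi.
Qed.
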